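(* Let $q$ be a prime power, $m,k$ positive integers and $\rho\in\{1,\ldots,\min\{k,m\}\}$. Then: (a) if $\rho<\min\{k,m\}$, then $s_{q^m/q}(k,\rho+1)\le s_{q^m/q}(k,\rho)$; (b) $s_{q^m/q}(k,\rho)\le s_{q^m/q}(k+1,\rho)-1$; (c) if $\rho<m$, then $s_{q^m/q}(k+1,\rho+1)\le s_{q^m/q}(k,\rho)+1$.
   Context: An $[n,k]_{q^m/q}$ system is an $n$-dimensional $\mathbb{F}_q$-subspace $\mathcal{U}\le\mathbb{F}_{q^m}^k$ with $\langle\mathcal{U}\rangle_{\mathbb{F}_{q^m}}=\mathbb{F}_{q^m}^k$; its linear set is $L_\mathcal{U}=\{\langle u\rangle_{\mathbb{F}_{q^m}}:u\in\mathcal{U}\setminus\{0\}\}\subseteq\mathrm{PG}(k-1,q^m)$. A point set $\mathcal{S}$ of $\mathrm{PG}(k-1,q^m)$ is $r$-saturating if every point lies in the span of some $r+1$ points of $\mathcal{S}$ and $r$ is minimal with this property; $\mathcal{U}$ is rank-$\rho$-saturating if $L_\mathcal{U}$ is $(\rho-1)$-saturating. For $\rho\in\{1,\ldots,\min\{k,m\}\}$, $s_{q^m/q}(k,\rho)$ is the minimum $n$ such that an $[n,k]_{q^m/q}$ rank-$\rho$-saturating system exists. *)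

(* Defs.v *)
From HB Require Import structures.
From mathcomp Require Import all_boot all_order all_algebra all_field.
From mathcomp Require Import boolp.
Set Implicit Arguments.
Unset Strict Implicit.
Unset Printing Implicit Defensive.
Import GRing.Theory.
Local Open Scope ring_scope.

Section RankSaturating.

Variables (F : finFieldType) (L : fieldExtType F).

(* L^k is used in two guises: {ffun 'I_k -> L}, whose canonical vector space
   structure is the one over F, and 'rV[L]_k, whose canonical structure is the
   one over L.  The map below identifies them. *)
Definition row_of (k : nat) (u : {ffun 'I_k -> L}) : 'rV[L]_k := \row_i u i.

(* The last clause says that the smallest L-subspace containing U is L^k. *)
Definition is_system (n k : nat) (U : {vspace {ffun 'I_k -> L}}) : Prop :=
  \dim U = n /\
  forall V : {vspace 'rV[L]_k},
    (forall u, u \in U -> row_of u \in V) -> V = fullv.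

Definition is_point (k : nat) (P : {vspace 'rV[L]_k}) : Prop := \dim P = 1%N.

Definition linear_set (k : nat) (U : {vspace {ffun 'I_k -> L}})
    (P : {vspace 'rV[L]_k}) : Prop :=
  exists u, [/\ u \in U, u != 0 & P = <[row_of u]>%VS].

(* The r.+1 points need not be distinct.  The minimal r below is the same as
   with distinct points: a point that is not in the span of any r points of S
   forces S to have at least r.+1 points. *)
Definition covers (k : nat) (S : {vspace 'rV[L]_k} -> Prop) (r : nat) : Prop :=
  forall P, is_point P ->
    exists Q : 'I_r.+1 -> {vspace 'rV[L]_k},
      (forall i, S (Q i)) /\ (P <= \sum_i Q i)%VS.

Definition saturating (k : nat) (S : {vspace 'rV[L]_k} -> Prop) (r : nat) :
    Prop :=
  covers S r /\ forall r', covers S r' -> (r <= r')%N.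

(* Meaningful for 0 < rho only, because of the truncated predecessor. *)
Definition rank_saturating (k : nat) (U : {vspace {ffun 'I_k -> L}})
    (rho : nat) : Prop :=
  saturating (linear_set U) rho.-1.

Definition has_system (k rho n : nat) : Prop :=
  exists U : {vspace {ffun 'I_k -> L}}, is_system n U /\ rank_saturating U rho.

(* The default value 0 is not reached when 0 < rho <= minn k (\dim {:L}), see
   sminP. *)
Definition smin (k rho : nat) : nat :=
  if pselect (exists n, `[< has_system k rho n >]) is left h
  then ex_minn h else 0%N.

(* The vectors whose first rho coordinates lie in F (1%VS is F inside L); they
   form a rank-rho-saturating system, the witness of smin_exists. *)
Definition sysU (k rho : nat) : {vspace {ffun 'I_k -> L}} :=
  (\bigcap_(i < k | (i < rho)%N)
     (linfun (fun u : {ffun 'I_k -> L} => u i) @^-1: 1%VS))%VS.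

Lemma mem_sysU k rho (u : {ffun 'I_k -> L}) :
  reflect (forall i : 'I_k, (i < rho)%N -> u i \in 1%VS) (u \in sysU k rho).
Proof.
have lin (i : 'I_k) (v : {ffun 'I_k -> L}) :
    linfun (fun u : {ffun 'I_k -> L} => u i) v = v i.
  pose f (u : {ffun 'I_k -> L}) := u i.
  have fl : linear f by move=> a x y; rewrite /f !ffunE.
  pose fL := GRing.isLinear.Build F {ffun 'I_k -> L} L _ f fl.
  pose g : {linear {ffun 'I_k -> L} -> L} := HB.pack f fL.
  exact: (lfunE g v).
apply: (iffP idP).
  rewrite memvE => /subv_bigcapP h i hi.
  by have := h i hi; rewrite -memvE -memv_preim lin.
move=> h; rewrite memvE; apply/subv_bigcapP => i hi.
by rewrite -memvE -memv_preim lin h.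
Qed.

Lemma smin_exists (k rho : nat) :
  (0 < rho <= minn k (\dim {:L}))%N -> exists n, has_system k rho n.
Proof.
case: rho => // rho; rewrite ltnS leq_min => /and3P[_ hk hm].
pose U := sysU k rho.+1; pose w := widen_ord hk.
exists (\dim U), U; split; [split=> // V hV|split].
- apply/eqP; rewrite eqEsubv subvf; apply/subvP => v _.
  rewrite (row_sum_delta v); apply: memv_suml => i _; apply: memvZ.
  have -> : delta_mx 0 i = row_of [ffun j => (j == i)%:R].
    by apply/rowP => j; rewrite !mxE !ffunE.
  by apply/hV/mem_sysU => j _; rewrite ffunE; case: eqP; rewrite ?mem1v ?mem0v.
- move=> P Pp; pose v := vpick P.
  have v0 : v != 0.
    by rewrite vpick0; apply: contra_eqN Pp => /eqP->; rewrite dimv0.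
  have -> : P = <[v]>%VS.
    by apply/esym/eqP; rewrite eqEdim -memvE memv_pick dim_vline v0 Pp.
  have [j0 hj0|h0] := pickP (fun j : 'I_rho.+1 => v 0 (w j) != 0); last first.
    have rv : row_of [ffun j => v 0 j] = v.
      by apply/rowP => j; rewrite !mxE !ffunE.
    exists (fun=> <[v]>%VS); split; last exact: (sumv_sup ord0).
    move=> i; exists [ffun j => v 0 j]; split; last by rewrite rv.
      apply/mem_sysU => j hj; rewrite ffunE.
      have /negbFE/eqP := h0 (Ordinal hj).
      by rewrite (_ : w _ = j) => [->|]; [rewrite mem0v | apply/val_inj].
    apply: contra v0 => /eqP e0; rewrite -rv e0.
    by apply/eqP/rowP => j; rewrite !mxE ffunE.
  pose u (j : 'I_rho.+1) : {ffun 'I_k -> L} :=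
    [ffun i : 'I_k => if (i < rho.+1)%N then (i == w j)%:R
                      else if j == j0 then v 0 i / v 0 (w j0) else 0].
  exists (fun j => <[row_of (u j)]>%VS); split=> [j|].
    exists (u j); split=> //.
      apply/mem_sysU => i hi; rewrite ffunE hi.
      by case: eqP; rewrite ?mem1v ?mem0v.
    apply/eqP => /ffunP/(_ (w j)); rewrite !ffunE /= ltn_ord eqxx.
    by move/eqP; rewrite oner_eq0.
  rewrite -memvE; apply/memv_sumP.
  exists (fun j => v 0 (w j) *: row_of (u j)) => [j _|].
    by rewrite memvZ ?memv_line.
  apply/rowP => i; rewrite summxE.
  have [hi|/negbTE hi] := boolP (i < rho.+1)%N;
    under eq_bigr => j _ do rewrite !mxE ffunE hi.
    have ei : i = w (Ordinal hi) by apply/val_inj.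
    rewrite (bigD1 (Ordinal hi)) //= -ei eqxx mulr1 big1 ?addr0 // => j jn.
    rewrite (_ : _ == _ = false) ?mulr0 //; apply: contraNF jn => /eqP e.
    by apply/eqP/val_inj; rewrite /= e.
  rewrite (bigD1 j0) //= eqxx mulrC divfK // big1 ?addr0 // => j /negbTE->.
  by rewrite mulr0.
- move=> r hr /=; have bf := basis_free (vbasisP {:L}).
  pose b := [ffun i : 'I_k => if (i < rho.+1)%N then (vbasis {:L})`_i else 0].
  have b0 : b (w ord0) != 0.
    rewrite ffunE /=; apply: (free_not0 bf).
    by rewrite mem_nth // size_tuple (leq_trans _ hm).
  have [|Q [hQ]] := hr <[row_of b]>%VS.
    rewrite /is_point dim_vline; suff -> : row_of b != 0 by [].
    by apply: contraNneq b0 => /rowP/(_ (w ord0)); rewrite !mxE => ->.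
  rewrite -memvE => /memv_sumP[vs hvs e].
  have /fin_all_exists[c hc] i : exists c : L * {ffun 'I_k -> L},
      c.2 \in U /\ vs i = c.1 *: row_of c.2.
    have [u [uU _ Qu]] := hQ i.
    by have := hvs i isT; rewrite Qu => /vlineP[a ->]; exists (a, u).
  pose l := [seq (c i).1 | i <- enum 'I_r.+1].
  have sub : (<<take rho.+1 (vbasis {:L})>> <= <<l>>)%VS.
    apply/span_subvP => x /(nthP 0)[i].
    rewrite size_take size_tuple => hi <-.
    have {}hi : (i < rho.+1)%N.
      by move: hi; case: ifPn => // hn hi; rewrite (leq_trans hi) // leqNgt.
    rewrite nth_take //.
    have := congr1 (fun A : 'rV[L]_k => A 0 (w (Ordinal hi))) e.
    rewrite /= mxE ffunE /= hi => ->; rewrite summxE memv_suml // => j _.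
    have [cU ->] := hc j; rewrite !mxE.
    have /mem_sysU/(_ (w (Ordinal hi)) hi)/vlineP[a ->] := cU.
    rewrite -scalerAr mulr1; apply/memvZ/memv_span/mapP.
    by exists j; rewrite ?mem_enum.
  have ft : free (take rho.+1 (vbasis {:L})).
    by move: bf; rewrite -{1}(cat_take_drop rho.+1 (vbasis {:L})) => /catl_free.
  have := leq_trans (dimvS sub) (dim_span l).
  by rewrite (eqnP ft) size_map size_enum_ord size_takel ?size_tuple.
Qed.

Lemma sminP (k rho : nat) : (0 < rho <= minn k (\dim {:L}))%N ->
  has_system k rho (smin k rho) /\
  forall n, has_system k rho n -> (smin k rho <= n)%N.
Proof.
move=> /smin_exists[n0 h0]; rewrite /smin; case: pselect => [h|[]].
  case: ex_minnP => n /asboolP hn min; split=> // n' /asboolP; exact: min.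
by exists n0; apply/asboolP.
Qed.

End RankSaturating.

(* Main.v *)
(** Describe an F-subspace of L^k by a matrix [G] whose rows span it over F; it
    is covering with [t] vectors if every vector of L^k is an L-combination of
    [t] vectors of the subspace.  The three bounds come from three operations on
    [G] that control this [t]: doing nothing, projecting from a row, and taking
    a direct sum with [1].  The point is that [smin] requires the least [t] to
    be exactly [rho].  Multiplying one row of [G] by a nonzero scalar of L
    increases the least [t] by at most one.  So if no matrix with at most [n]
    rows has least number [t + 1], a matrix covering with [t] vectors keeps
    doing so after any rescaling of its rows.  If its rows are L-dependent, a
    rescaling makes them F-dependent and one row can be deleted.  Hence
    one reaches an L-basis of L^k, whose least number is
    [min (k, [L : F]) > t], a contradiction. *)
Require Import Defs.
From mathcomp Require Import all_boot all_order all_algebra all_field.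
From mathcomp Require Import boolp.
Set Implicit Arguments.
Unset Strict Implicit.
Unset Printing Implicit Defensive.
Import GRing.Theory.
Local Open Scope ring_scope.

Section RowScaling.

Variable R : nzSemiRingType.

Definition scale_row_mx n (i : 'I_n) (a : R) : 'M[R]_n :=
  diag_mx (\row_j (if j == i then a else 1)).

Lemma diag_mx_mul_ind n k (a : 'rV[R]_n) (P : 'M[R]_(n, k) -> Prop) :
  (forall i G, P G -> P (scale_row_mx i (a 0 i) *m G)) ->
  forall G, P G -> P (diag_mx a *m G).
Proof.
move=> P_scale G PG.
pose b s : 'rV[R]_n := \row_j \prod_(i <- s | j == i) a 0 i.
suff Pb s : P (diag_mx (b s) *m G).
  suff <- : b (index_enum 'I_n) = a by [].
  by apply/rowP => j; rewrite mxE (big_pred1 j) // => i; rewrite eq_sym.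
elim: s => [|i s IHs].
  have -> : b [::] = const_mx 1 by apply/rowP => j; rewrite !mxE big_nil.
  by rewrite diag_const_mx mul1mx.
have -> : diag_mx (b (i :: s)) = scale_row_mx i (a 0 i) *m diag_mx (b s).
  rewrite mulmx_diag; congr diag_mx; apply/rowP => j; rewrite !mxE big_cons.
  by case: eqP => [->|_]; rewrite ?mul1r.
by rewrite -mulmxA; apply: P_scale.
Qed.

End RowScaling.

Section RankCovering.

Variables (F : fieldType) (L : fieldExtType F).

Local Notation "A ^L" := (map_mx (in_alg L) A) (at level 8, format "A ^L").

(* The rows of A^L *m G are t vectors of the F-span of the rows of G. *)
Definition rank_covering (n k : nat) (G : 'M[L]_(n, k)) (t : nat) : Prop :=
  forall v : 'rV[L]_k, exists (c : 'rV[L]_t) (A : 'M[F]_(t, n)),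
    v = c *m A^L *m G.

Definition rank_saturating_mx (n k : nat) (G : 'M[L]_(n, k)) (t : nat) : Prop :=
  rank_covering G t /\ forall s, rank_covering G s -> (t <= s)%N.

Lemma rank_covering_row_full n k (G : 'M[L]_(n, k)) t :
  rank_covering G t -> row_full G.
Proof.
move=> covG; rewrite -sub1mx; apply/row_subP => i.
by have [c [A ->]] := covG (row i 1%:M); rewrite submxMl.
Qed.

Lemma rank_covering1 n : rank_covering (1%:M : 'M[L]_n) n.
Proof. by move=> v; exists v, 1%:M; rewrite map_mx1 !mulmx1. Qed.

Lemma rank_covering_block n1 n2 k1 k2 (G : 'M[L]_(n1, k1)) (H : 'M_(n2, k2))
    s t :
  rank_covering G s -> rank_covering H t ->
  rank_covering (block_mx G 0 0 H) (s + t).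
Proof.
move=> covG covH v.
have [c [A vG]] := covG (lsubmx v); have [d [B vH]] := covH (rsubmx v).
exists (row_mx c d), (block_mx A 0 0 B).
rewrite map_block_mx !map_mx0 !mul_row_block !mulmx0 !addr0 !add0r.
by rewrite -vG -vH hsubmxK.
Qed.

Lemma rank_covering_mulmxr n k l (G : 'M[L]_(n, k)) (M : 'M[L]_(k, l)) t :
  row_full M -> rank_covering G t -> rank_covering (G *m M) t.
Proof.
move=> /row_fullP[N NM] covG v; have [c [A vN]] := covG (v *m N).
by exists c, A; rewrite mulmxA -vN -mulmxA NM mulmx1.
Qed.

Lemma rank_covering_perturb n p k r (B : 'M[F]_(n, p)) (C : 'M[L]_(n, r))
    (D : 'M[F]_(r, p)) (G : 'M[L]_(p, k)) t :
  rank_covering ((B^L + C *m D^L) *m G) t -> rank_covering G (t + r).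
Proof.
move=> covG v; have [c [A ->]] := covG v.
exists (row_mx c (c *m A^L *m C)), (col_mx (A *m B) D).
rewrite map_col_mx map_mxM mul_row_col mulmxA; congr (_ *m G).
by rewrite mulmxDr !mulmxA.
Qed.

Lemma rank_covering_mulmxl n p k (B : 'M[F]_(n, p)) (G : 'M[L]_(p, k)) t :
  rank_covering (B^L *m G) t -> rank_covering G t.
Proof.
move=> covG; rewrite -[t]addn0.
apply: (@rank_covering_perturb _ _ _ _ B 0 0).
by rewrite mul0mx addr0.
Qed.

Lemma rank_coveringW n k (G : 'M[L]_(n, k)) s t :
  (s <= t)%N -> rank_covering G s -> rank_covering G t.
Proof.
move=> /subnKC <- covG; apply: (@rank_covering_perturb _ _ _ _ 1%:M 0 0).
by rewrite map_mx1 mul0mx addr0 mul1mx.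
Qed.

Lemma rank_covering_scale_row n k (G : 'M[L]_(n, k)) i (a : L) t :
  a != 0 -> rank_covering G t -> rank_covering (scale_row_mx i a *m G) t.+1.
Proof.
move=> a0 covG; rewrite -addn1.
pose C : 'cV[L]_n := (a^-1 - 1) *: delta_mx i 0.
pose D : 'rV[F]_n := delta_mx 0 i.
apply: (@rank_covering_perturb _ _ _ _ 1%:M C D).
suff scaleK : (1%:M^L + C *m D^L) *m scale_row_mx i a = 1%:M.
  by rewrite mulmxA scaleK mul1mx.
rewrite map_mx1 map_delta_mx -scalemxAl mul_delta_mx.
apply/matrixP => h j; rewrite mul_mx_diag !mxE.
have [->|ji] := eqVneq j i; last by rewrite andbF mulr0 addr0 mulr1.
by case: eqVneq => _; rewrite ?mulr0 ?addr0 ?mul0r // mulr1 addrC subrK mulVf.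
Qed.

Lemma rank_covering_relations p n k (Y : 'M[F]_(p, n)) (G : 'M[L]_(n, k)) t :
  Y^L *m G = 0 -> rank_covering G t ->
  exists G' : 'M[L]_(n - \rank Y, k), rank_covering G' t.
Proof.
move=> YG covG; rewrite -mxrank_tr -mxrank_ker.
have : (G^T <= (row_base (kermx Y^T))^L)%MS.
  have /(map_eqmx (in_alg L)) -> := eq_row_base (kermx Y^T).
  by rewrite map_kermx; apply/sub_kermxP; rewrite -map_trmx -trmx_mul YG trmx0.
case/submxP => W GW; exists W^T.
apply: (@rank_covering_mulmxl _ _ _ (row_base (kermx Y^T))^T).
by rewrite -map_trmx -trmx_mul -GW trmxK.
Qed.

(* The rows of Y^L *m G are the vectors of the system that span the center of
   the projection. *)
Lemma rank_covering_project p n k (Y : 'M[F]_(p, n)) (G : 'M[L]_(n, k)) t :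
  rank_covering G t ->
  exists G' : 'M[L]_(n - \rank Y, k - \rank (Y^L *m G)), rank_covering G' t.
Proof.
move=> covG; pose M := cokermx (Y^L *m G).
rewrite -(mxrank_coker (Y^L *m G)) -/M.
apply: (@rank_covering_relations _ _ _ _ (G *m col_base M)).
  apply: (row_free_injr (row_base_free M)).
  by rewrite /= mul0mx -mulmxA -mulmxA mulmx_base mulmxA mulmx_coker.
exact/rank_covering_mulmxr/covG/col_base_full.
Qed.

Lemma rank_covering_project_row n k (G : 'M[L]_(n, k.+1)) t :
  rank_covering G t -> exists G' : 'M[L]_(n.-1, k), rank_covering G' t.
Proof.
move=> covG; have G0 : G != 0.
  by rewrite -mxrank_eq0 (eqP (rank_covering_row_full covG)).
have /matrix0Pn[i [j Gij]] := G0.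
have row0 : row i G != 0 by apply/rV0Pn; exists j; rewrite mxE.
have := rank_covering_project (delta_mx 0 i : 'rV[F]_n) covG.
by rewrite map_delta_mx -rowE mxrank_delta rank_rV row0 !subn1.
Qed.

Lemma row_free_rank_covering n k (G : 'M[L]_(n, k)) t :
  row_free G -> rank_covering G t -> (minn n (\dim {:L}) <= t)%N.
Proof.
move=> freeG covG; pose x : 'rV[L]_n := \row_i (vbasis {:L})`_i.
have [c [A /(row_free_injr freeG) x_comb]] := covG (x *m G).
pose l := [seq c 0 j | j <- enum 'I_t].
have sub_l : (<<take n (vbasis {:L})>> <= <<l>>)%VS.
  apply/span_subvP => _ /(nthP 0)[i ltin <-].
  have {}ltin : (i < n)%N.
    by move: ltin; rewrite size_take_min leq_min => /andP[].
  have -> : (take n (vbasis {:L}))`_i = x 0 (Ordinal ltin).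
    by rewrite mxE nth_take.
  rewrite x_comb mxE; apply: memv_suml => j _.
  rewrite mxE -scalerAr mulr1; apply/memvZ/memv_span/mapP.
  by exists j; rewrite ?mem_enum.
have free_take : free (take n (vbasis {:L})).
  have := basis_free (vbasisP {:L}).
  by rewrite -{1}(cat_take_drop n (vbasis {:L})) => /catl_free.
have := leq_trans (dimvS sub_l) (dim_span l).
by rewrite (eqnP free_take) size_take_min size_tuple size_map size_enum_ord.
Qed.

(* Scaling the rows by the coefficients of an L-linear relation turns it into
   an F-linear one. *)
Lemma rank_covering_delete_row n k (G : 'M[L]_(n, k)) t :
  ~~ row_free G ->
  (forall G' : 'M[L]_(n, k), rank_covering G' t.+1 -> rank_covering G' t) ->
  rank_covering G t -> exists G' : 'M[L]_(n.-1, k), rank_covering G' t.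
Proof.
rewrite -kermx_eq0 => /rowV0Pn[z /sub_kermxP zG /rV0Pn[i zi]] drop covG.
pose a : 'rV[L]_n := \row_j (if z 0 j == 0 then 1 else z 0 j).
pose y : 'rV[F]_n := \row_j (z 0 j != 0)%:R.
have a0 j : a 0 j != 0 by rewrite mxE; case: ifPn; rewrite ?oner_neq0.
have yaG : y^L *m (diag_mx a *m G) = 0.
  rewrite mulmxA -[RHS]zG; congr (_ *m G); apply/rowP => j.
  rewrite mul_mx_diag !mxE.
  by case: eqP => [->|_] /=; rewrite ?scale0r ?mul0r // scale1r mul1r.
have y0 : y != 0 by apply/rV0Pn; exists i; rewrite mxE zi oner_neq0.
have cov_aG : rank_covering (diag_mx a *m G) t.
  apply: (@diag_mx_mul_ind _ _ _ a (fun H => rank_covering H t)) => // j H covH.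
  exact/drop/rank_covering_scale_row.
by have := rank_covering_relations yaG cov_aG; rewrite rank_rV y0 subn1.
Qed.

Lemma rank_saturating_mxS n k (G : 'M[L]_(n, k)) t :
  rank_covering G t.+1 -> ~ rank_covering G t -> rank_saturating_mx G t.+1.
Proof.
move=> covG ncovG; split=> // s covGs; rewrite ltnNge; apply/negP => le_st.
exact/ncovG/(rank_coveringW le_st).
Qed.

Lemma exists_rank_saturating_mx n k (G : 'M[L]_(n, k)) t :
  (t <= minn k (\dim {:L}))%N -> rank_covering G t ->
  exists d (G' : 'M[L]_(d, k)), (d <= n)%N /\ rank_saturating_mx G' t.
Proof.
case: t => [_ covG|t lt_t]; first by exists n, G.
elim: n G => [|n IHn] G covG.
  have := rank_covering_row_full covG; rewrite /row_full flatmx0 mxrank0.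
  by move=> /eqP k0; rewrite -k0 min0n in lt_t.
have [//|no_witness] := pselect (exists d (G' : 'M[L]_(d, k)),
  (d <= n.+1)%N /\ rank_saturating_mx G' t.+1).
have drop (G' : 'M[L]_(n.+1, k)) : rank_covering G' t.+1 -> rank_covering G' t.
  move=> covG'; apply: contrapT => ncovG'; apply: no_witness.
  by exists n.+1, G'; split=> //; apply: rank_saturating_mxS.
have [freeG|dependentG] := boolP (row_free G).
  have le_kn : (k <= n.+1)%N.
    by rewrite -(eqP (rank_covering_row_full covG)) rank_leq_row.
  have := row_free_rank_covering freeG (drop _ covG).
  rewrite leqNgt (leq_trans lt_t) // leq_min geq_minr andbT.
  exact: leq_trans (geq_minl _ _) le_kn.
have [G1 covG1] := rank_covering_delete_row dependentG drop (drop _ covG).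
have [d [G' [le_dn satG']]] := IHn _ (rank_coveringW (leqnSn t) covG1).
by exists d, G'; rewrite leqW.
Qed.

End RankCovering.

Section RowSystem.

Variables (F : finFieldType) (L : fieldExtType F).

Local Notation "A ^L" := (map_mx (in_alg L) A) (at level 8, format "A ^L").

Definition ffun_of_row k (v : 'rV[L]_k) : {ffun 'I_k -> L} := [ffun j => v 0 j].

Lemma ffun_of_rowK k : cancel (@ffun_of_row k) (@row_of F L k).
Proof. by move=> v; apply/rowP => j; rewrite mxE ffunE. Qed.

Lemma row_ofK k : cancel (@row_of F L k) (@ffun_of_row k).
Proof. by move=> u; apply/ffunP => j; rewrite ffunE mxE. Qed.

Lemma row_of0 k : row_of (0 : {ffun 'I_k -> L}) = 0.
Proof. by apply/rowP => j; rewrite !mxE ffunE. Qed.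

Lemma is_pointP k (P : {vspace 'rV[L]_k}) :
  is_point P <-> exists2 v, v != 0 & P = <[v]>%VS.
Proof.
split=> [dimP|[v v0 ->]]; last by rewrite /is_point dim_vline v0.
have P0 : vpick P != 0.
  by rewrite vpick0; apply: contra_eqN dimP => /eqP->; rewrite dimv0.
exists (vpick P) => //; apply/esym/eqP.
by rewrite eqEdim -memvE memv_pick dim_vline P0 dimP.
Qed.

Lemma covers_linear_setP k (U : {vspace {ffun 'I_k -> L}}) r :
  covers (linear_set U) r <->
  forall v : 'rV[L]_k,
  exists (c : 'I_r.+1 -> L) (u : 'I_r.+1 -> {ffun 'I_k -> L}),
    (forall i, u i \in U) /\ v = \sum_i c i *: row_of (u i).
Proof.
split=> [covU v|combU P /is_pointP[v v0 ->]].
  have [->|v0] := eqVneq v 0.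
    exists (fun=> 0), (fun=> 0); split=> [i|]; first exact: mem0v.
    by rewrite big1 // => i _; rewrite scale0r.
  have [|Q [LQ]] := covU <[v]>%VS; first by apply/is_pointP; exists v.
  rewrite -memvE => /memv_sumP[w wQ ->].
  have /fin_all_exists2[cu cuU w_cu] i : exists2 cu : L * {ffun 'I_k -> L},
      cu.2 \in U & w i = cu.1 *: row_of cu.2.
    have [u [uU _ Qu]] := LQ i.
    by have := wQ i isT; rewrite Qu => /vlineP[c ->]; exists (c, u).
  exists (fun i => (cu i).1), (fun i => (cu i).2); split=> //.
  exact: eq_bigr.
have [c [u [uU v_comb]]] := combU v.
have [i0 ui0] : exists i, u i != 0.
  apply/existsP; apply: contraNT v0 => /existsPn u0; rewrite v_comb.
  by apply/eqP/big1 => i _; rewrite (eqP (negbNE (u0 i))) row_of0 scaler0.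
(* Zero vectors span no point of the linear set, so they are replaced. *)
pose u' i := if u i == 0 then u i0 else u i.
exists (fun i => <[row_of (u' i)]>%VS); split=> [i|].
  by exists (u' i); rewrite /u'; case: ifPn.
rewrite -memvE v_comb; apply/memv_sumP.
exists (fun i => c i *: row_of (u i)) => // i _; rewrite /u'.
by case: eqP => [->|_]; rewrite ?row_of0 ?scaler0 ?mem0v // memvZ ?memv_line.
Qed.

Definition row_system d k (G : 'M[L]_(d, k)) : {vspace {ffun 'I_k -> L}} :=
  <<[tuple ffun_of_row (row i G) | i < d]>>%VS.

Lemma dim_row_system_le d k (G : 'M[L]_(d, k)) : (\dim (row_system G) <= d)%N.
Proof. by rewrite (leq_trans (dim_span _)) ?size_tuple. Qed.

Lemma row_systemP d k (G : 'M[L]_(d, k)) u :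
  reflect (exists a : 'rV[F]_d, row_of u = a^L *m G) (u \in row_system G).
Proof.
set X := [tuple ffun_of_row (row i G) | i < d].
have combX (a : 'rV[F]_d) : row_of (\sum_i a 0 i *: X`_i) = a^L *m G.
  apply/rowP => j; rewrite !mxE sum_ffunE; apply: eq_bigr => i _.
  by rewrite -tnth_nth tnth_mktuple !ffunE !mxE -scalerAl mul1r.
apply: (iffP idP) => [uX|[a ua]].
  exists (\row_i coord X i u); rewrite -combX {1}(coord_span uX).
  by congr row_of; apply: eq_bigr => i _; rewrite mxE.
rewrite -[u]row_ofK ua -combX row_ofK; apply: memv_suml => i _.
by apply/memvZ/memv_span; rewrite mem_nth ?size_tuple.
Qed.

Lemma row_system_vbasis k (U : {vspace {ffun 'I_k -> L}}) :
  row_system (\matrix_(i < \dim U) row_of (vbasis U)`_i) = U.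
Proof.
rewrite -[RHS](span_basis (vbasisP U)); congr (<<_>>)%VS; congr tval.
by apply: eq_from_tnth => i; rewrite tnth_mktuple rowK row_ofK -tnth_nth.
Qed.

Lemma row_full_is_system d k (G : 'M[L]_(d, k)) :
  row_full G -> is_system (\dim (row_system G)) (row_system G).
Proof.
move=> /row_fullP[H HG]; split=> // V sGV.
apply/eqP; rewrite eqEsubv subvf; apply/subvP => v _.
rewrite -[v]mulmx1 -HG mulmxA mulmx_sum_row; apply: memv_suml => i _.
rewrite -[row i G]ffun_of_rowK; apply/memvZ/sGV/row_systemP.
by exists (delta_mx 0 i); rewrite ffun_of_rowK map_delta_mx -rowE.
Qed.

Lemma covers_row_system d k (G : 'M[L]_(d, k)) r :
  covers (linear_set (row_system G)) r <-> rank_covering G r.+1.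
Proof.
have rows_comb (c : 'rV[L]_r.+1) (A : 'M[F]_(r.+1, d)) :
    c *m A^L *m G = \sum_i c 0 i *: ((row i A)^L *m G).
  rewrite -mulmxA mulmx_sum_row; apply: eq_bigr => i _.
  by rewrite row_mul map_row.
rewrite covers_linear_setP; split=> cov v.
  have [c [u [uG ->]]] := cov v.
  have /fin_all_exists[a ua] i := row_systemP _ _ (uG i).
  exists (\row_i c i), (\matrix_i a i); rewrite rows_comb.
  by apply: eq_bigr => i _; rewrite mxE rowK ua.
have [c [A ->]] := cov v.
exists (c 0), (fun i => ffun_of_row ((row i A)^L *m G)); split=> [i|].
  by apply/row_systemP; exists (row i A); rewrite ffun_of_rowK.
by rewrite rows_comb; apply: eq_bigr => i _; rewrite ffun_of_rowK.
Qed.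

Lemma has_system_rank_covering k rho n :
  (0 < rho)%N -> has_system L k rho n ->
  exists G : 'M[L]_(n, k), rank_covering G rho.
Proof.
move=> rho0 [U [[<- _] [covU _]]].
exists (\matrix_(i < \dim U) row_of (vbasis U)`_i).
by rewrite -(prednK rho0); apply/covers_row_system; rewrite row_system_vbasis.
Qed.

Lemma rank_saturating_mx_has_system k rho d (G : 'M[L]_(d, k)) :
  (0 < rho)%N -> rank_saturating_mx G rho ->
  has_system L k rho (\dim (row_system G)).
Proof.
case: rho => // rho _ [covG minG]; exists (row_system G); split.
  exact/row_full_is_system/(rank_covering_row_full covG).
by split=> [|r /covers_row_system/minG //]; apply/covers_row_system.
Qed.

Lemma smin_le k rho n (G : 'M[L]_(n, k)) :
  (0 < rho <= minn k (\dim {:L}))%N -> rank_covering G rho ->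
  (smin L k rho <= n)%N.
Proof.
move=> rho_bd covG; have /andP[rho0 rho_le] := rho_bd.
have [d [G' [le_dn satG']]] := exists_rank_saturating_mx rho_le covG.
apply: leq_trans (leq_trans (dim_row_system_le G') le_dn).
exact/(sminP rho_bd).2/rank_saturating_mx_has_system.
Qed.

Lemma smin_rank_covering k rho :
  (0 < rho <= minn k (\dim {:L}))%N ->
  exists G : 'M[L]_(smin L k rho, k), rank_covering G rho.
Proof.
move=> rho_bd; apply: has_system_rank_covering (sminP rho_bd).1.
by case/andP: rho_bd.
Qed.

Lemma smin_gt0 k rho :
  (0 < rho <= minn k (\dim {:L}))%N -> (0 < smin L k rho)%N.
Proof.
move=> rho_bd; have [G covG] := smin_rank_covering rho_bd.
apply: leq_trans (rank_leq_row G).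
rewrite (eqP (rank_covering_row_full covG)).
move: rho_bd; rewrite leq_min => /and3P[rho0 le_rhok _].
exact: leq_trans le_rhok.
Qed.

End RowSystem.

Local Close Scope ring_scope.

Theorem theorem3p6 (F : finFieldType) (L : fieldExtType F) (m k rho : nat)
    (hm : \dim {: L} = m) (hk : 0 < k) (hrho : 1 <= rho <= minn k m) :
  [/\ (rho < minn k m -> smin L k (rho + 1) <= smin L k rho),
      smin L k rho + 1 <= smin L (k + 1) rho
    & (rho < m -> smin L (k + 1) (rho + 1) <= smin L k rho + 1)].
Proof.
subst m; have [G covG] := smin_rank_covering hrho.
have /and3P[rho0 le_rhok le_rhoL] : [&& 0 < rho, rho <= k & rho <= \dim {:L}].
  by rewrite -leq_min.
split=> [lt_rho||lt_rhoL].
- apply: smin_le (rank_coveringW (leq_addr 1 rho) covG).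
  by rewrite addn1.
- have hrho1 : 0 < rho <= minn k.+1 (\dim {:L}) by rewrite rho0 leq_min leqW.
  rewrite !addn1; have [G1 covG1] := smin_rank_covering hrho1.
  have [G2 covG2] := rank_covering_project_row covG1.
  by rewrite -(prednK (smin_gt0 hrho1)) ltnS; apply: smin_le covG2.
- apply: (smin_le _ (rank_covering_block covG (@rank_covering1 _ _ 1))).
  by rewrite !addn1 leq_min !ltnS le_rhok.
Qed.
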